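(* Let $n\ge 1$ and $\mathsf{P}_n^{ext}=\mathbb{Q}[x_1,\dots,x_n]\otimes\bigwedge[\omega_1,\dots,\omega_n]$ with the $W_{B_n}$-action recalled in the context. For $1\le i\le n$ set $\partial_i=\dfrac{\mathbf 1-s_i}{x_i-s_i(x_i)}$. Equivalently, for $1\le i\le n-1$ and $1\le j\le n$, $$\partial_i(x_i)=1,\quad \partial_i(x_{i+1})=-1,\quad \partial_i(x_j)=0\ (j\ne i,i+1),\quad \partial_i(\omega_j)=-\delta_{ij}(x_i+x_{i+1})\omega_{i+1},$$ and $\partial_n(x_j)=\delta_{jn}$, $\partial_n(\omega_j)=0$ for all $1\le j\le n$, extended to all of $\mathsf{P}_n^{ext}$ by the Leibniz rule $\partial_i(fg)=\partial_i(f)g+s_i(f)\partial_i(g)$. Then this defines an action of the type $B$ Demazure operators on $\mathsf{P}_n^{ext}$; that is, the $\partial_i$ are well-defined operators on $\mathsf{P}_n^{ext}$ satisfying $$\partial_i^2=0\ (1\le i\le n),\qquad \partial_i\partial_j=\partial_j\partial_i\ (|i-j|>1),$$ $$\partial_i\partial_{i+1}\partial_i=\partial_{i+1}\partial_i\partial_{i+1}\ (1\le i<n-1),\qquad \partial_{n-1}\partial_n\partial_{n-1}\partial_n=\partial_n\partial_{n-1}\partial_n\partial_{n-1}.$$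
   Context: $W_{B_n}$ is the Weyl group of type $B_n$ with simple reflections $s_1,\dots,s_n$ ($s_1,\dots,s_{n-1}$ generating $S_n$, and $s_n$ the sign-change reflection). It acts on $\mathsf{P}_n^{ext}$ by algebra automorphisms: for $i<n$, $s_i(x_j)=x_{s_i(j)}$ and $s_i(\omega_j)=\omega_j+\delta_{ij}(x_i^2-x_{i+1}^2)\omega_{i+1}$; and $s_n(x_j)=x_j$ for $j<n$, $s_n(x_n)=-x_n$, $s_n(\omega_j)=\omega_j$ for all $j$. $\bigwedge[\omega_1,\dots,\omega_n]$ is the exterior algebra over $\mathbb{Q}$; the $x_i$ commute with the $\omega_j$. *)

(* Defs.v *)
From HB Require Import structures.
From mathcomp Require Import all_boot all_order all_fingroup all_algebra.
From mathcomp Require Import mpoly ring.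
Set Implicit Arguments.
Unset Strict Implicit.
Unset Printing Implicit Defensive.
Import GRing.Theory.
Local Open Scope ring_scope.

Section ExteriorAlgebra.
Variables (K : comNzRingType) (A : comAlgType K) (n : nat).

(* A (x)_K /\_K[w_0, ..., w_(n-1)], realized as the free A-module on the ordered
   monomials w_S = w_(s_1) w_(s_2) ... (s_1 < s_2 < ...): the element with
   coefficients f is \sum_S (f S) w_S (see extE below).  A record rather than a
   synonym, because {ffun _ -> A} already carries the pointwise product. *)
Record extalg := ExtAlg { extcoef : {ffun {set 'I_n} -> A} }.

HB.instance Definition _ := [isNew for extcoef].
HB.instance Definition _ := [Choice of extalg by <:].

Implicit Types (f g h : extalg) (S T U V : {set 'I_n}).

Definition ext_zero := ExtAlg 0.
Definition ext_opp f := ExtAlg (- extcoef f).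
Definition ext_add f g := ExtAlg (extcoef f + extcoef g).
Definition ext_scale (c : K) f := ExtAlg (c *: extcoef f).

Fact ext_addA : associative ext_add.
Proof. by move=> f g h; apply: val_inj; rewrite /= addrA. Qed.
Fact ext_addC : commutative ext_add.
Proof. by move=> f g; apply: val_inj; rewrite /= addrC. Qed.
Fact ext_add0 : left_id ext_zero ext_add.
Proof. by move=> f; apply: val_inj; rewrite /= add0r. Qed.
Fact ext_addN : left_inverse ext_zero ext_opp ext_add.
Proof. by move=> f; apply: val_inj; rewrite /= addNr. Qed.

HB.instance Definition _ :=
  GRing.isZmodule.Build extalg ext_addA ext_addC ext_add0 ext_addN.

Fact ext_scaleA a b f : ext_scale a (ext_scale b f) = ext_scale (a * b) f.
Proof. by apply: val_inj; rewrite /= scalerA. Qed.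
Fact ext_scale1 : left_id 1 ext_scale.
Proof. by move=> f; apply: val_inj; rewrite /= scale1r. Qed.
Fact ext_scaleDr : right_distributive ext_scale +%R.
Proof. by move=> a f g; apply: val_inj; rewrite /= scalerDr. Qed.
Fact ext_scaleDl f : {morph ext_scale^~ f : a b / a + b}.
Proof. by move=> a b; apply: val_inj; rewrite /= scalerDl. Qed.

HB.instance Definition _ := GRing.Zmodule_isLmodule.Build K extalg
  ext_scaleA ext_scale1 ext_scaleDr ext_scaleDl.

Lemma extalgP f g : (forall S, extcoef f S = extcoef g S) <-> f = g.
Proof. by split=> [fg|-> //]; apply: val_inj; apply/ffunP. Qed.

Lemma extcoefD f g S : extcoef (f + g) S = extcoef f S + extcoef g S.
Proof. by rewrite ffunE. Qed.
Lemma extcoefZ c f S : extcoef (c *: f) S = c *: extcoef f S.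
Proof. by rewrite ffunE. Qed.
Lemma extcoef0 S : extcoef 0 S = 0.
Proof. by rewrite ffunE. Qed.
Lemma extcoefN f S : extcoef (- f) S = - extcoef f S.
Proof. by rewrite ffunE. Qed.
Lemma extcoef_sum (I : Type) (r : seq I) (P : pred I) (F : I -> extalg) S :
  extcoef (\sum_(i <- r | P i) F i) S = \sum_(i <- r | P i) extcoef (F i) S.
Proof. by elim/big_rec2: _ => [|i y1 y2 _ <-]; rewrite ?extcoef0 ?extcoefD. Qed.

(* w_S w_T = (-1)^(ninv S T) w_(S :|: T) for disjoint S and T: ninv counts the
   transpositions needed to sort the concatenated monomial. *)
Definition ninv S T : nat := \sum_(i in S) \sum_(j in T) (j < i)%N.

Definition ext_one := ExtAlg [ffun S => (S == set0)%:R].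
Definition ext_mul f g := ExtAlg [ffun U : {set 'I_n} =>
  \sum_(S : {set 'I_n} | S \subset U)
     (-1) ^+ ninv S (U :\: S) * (extcoef f S * extcoef g (U :\: S))].

Lemma sum_setU S T (F : 'I_n -> nat) : [disjoint S & T] ->
  (\sum_(i in S :|: T) F i = \sum_(i in S) F i + \sum_(i in T) F i)%N.
Proof. by move=> dST; rewrite -bigU //; apply: eq_bigl => k; rewrite !inE. Qed.
Lemma ninvUl S T V : [disjoint S & T] ->
  ninv (S :|: T) V = (ninv S V + ninv T V)%N.
Proof. exact: sum_setU. Qed.
Lemma ninvUr S T V : [disjoint S & T] ->
  ninv V (S :|: T) = (ninv V S + ninv V T)%N.
Proof.
by move=> dST; rewrite /ninv -big_split; apply: eq_bigr => i _; apply: sum_setU.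
Qed.
Lemma ninv0l T : ninv set0 T = 0%N.
Proof. by rewrite /ninv big_set0. Qed.
Lemma ninv0r T : ninv T set0 = 0%N.
Proof. by rewrite /ninv big1 // => i _; rewrite big_set0. Qed.

Lemma setDUl_disj S T : [disjoint S & T] -> (S :|: T) :\: S = T.
Proof.
move=> dST; apply/setP => x; rewrite !inE; case xS: (x \in S) => //=.
by rewrite (disjointFr dST xS).
Qed.

Fact ext_mulA : associative ext_mul.
Proof.
move=> f g h; apply/extalgP => U; rewrite !ffunE /=.
under [RHS]eq_bigr => V sVU do rewrite ffunE mulr_suml mulr_sumr.
rewrite [RHS](exchange_big_dep (fun S => S \subset U)) /=; last first.
  by move=> V S sVU sSV; apply: subset_trans sVU.
apply: eq_bigr => S sSU; rewrite ffunE mulr_sumr mulr_sumr.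
rewrite [RHS](reindex_onto (fun T => S :|: T) (fun V => V :\: S)) /=; last first.
  move=> V /andP[_ sSV]; apply/setP => x; rewrite !inE; move/subsetP/(_ x): sSV.
  by case: (x \in S) => // ->.
have setDK T : (((S :|: T) :\: S) == T) = [disjoint T & S].
  apply/eqP/idP => [<-|]; last by rewrite disjoint_sym => /setDUl_disj.
  by rewrite disjoints_subset; apply/subsetP => x; rewrite !inE => /andP[].
apply: eq_big => [T|T].
  by rewrite subUset sSU subsetUl setDK subsetD andbT.
rewrite subsetD disjoint_sym => /andP[sTU dST].
rewrite setDUl_disj // -setDDl.
have -> : ninv S (U :\: S) = (ninv S T + ninv S (U :\: S :\: T))%N.
  rewrite -ninvUr; last first.
    by rewrite disjoints_subset; apply/subsetP => x; rewrite !inE => ->.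
  congr ninv; apply/setP => x; rewrite !inE.
  case xT: (x \in T) => //=.
  by rewrite (subsetP sTU) // andbT (disjointFl dST xT).
by rewrite ninvUl // !exprD; ring.
Qed.

Fact ext_mul1l : left_id ext_one ext_mul.
Proof.
move=> f; apply/extalgP => U; rewrite !ffunE (bigD1 set0) ?sub0set //=.
rewrite big1 => [|S /andP[_ /negPf nS]]; last by rewrite ffunE nS mul0r mulr0.
by rewrite ninv0l ffunE eqxx setD0 !mul1r addr0.
Qed.
Fact ext_mul1r : right_id ext_one ext_mul.
Proof.
move=> f; apply/extalgP => U; rewrite !ffunE (bigD1 U) //=.
rewrite big1 => [|S /andP[sSU nSU]]; last first.
  rewrite ffunE setD_eq0; case sUS: (U \subset S) => /=; last by rewrite !mulr0.
  by rewrite eqEsubset sSU sUS in nSU.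
by rewrite setDv ninv0r ffunE eqxx mulr1 mul1r addr0.
Qed.
Fact ext_mulDl : left_distributive ext_mul +%R.
Proof.
move=> f g h; apply/extalgP => U; rewrite !ffunE -big_split; apply: eq_bigr => S _ /=.
by rewrite extcoefD mulrDl mulrDr.
Qed.
Fact ext_mulDr : right_distributive ext_mul +%R.
Proof.
move=> f g h; apply/extalgP => U; rewrite !ffunE -big_split; apply: eq_bigr => S _ /=.
by rewrite extcoefD !mulrDr.
Qed.
Fact ext_1neq0 : ext_one != 0.
Proof.
apply/eqP => /extalgP/(_ set0); rewrite !ffunE eqxx => /eqP.
by rewrite oner_eq0.
Qed.

HB.instance Definition _ := GRing.Zmodule_isNzRing.Build extalg
  ext_mulA ext_mul1l ext_mul1r ext_mulDl ext_mulDr ext_1neq0.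

Fact ext_scaleAl (c : K) f g : c *: (f * g) = (c *: f) * g.
Proof.
apply/extalgP => U; rewrite !ffunE scaler_sumr; apply: eq_bigr => S _ /=.
by rewrite extcoefZ -scalerAl -scalerAr.
Qed.
Fact ext_scaleAr (c : K) f g : c *: (f * g) = f * (c *: g).
Proof.
apply/extalgP => U; rewrite !ffunE scaler_sumr; apply: eq_bigr => S _ /=.
by rewrite extcoefZ -!scalerAr.
Qed.
HB.instance Definition _ := GRing.Lmodule_isLalgebra.Build K extalg ext_scaleAl.
HB.instance Definition _ := GRing.Lalgebra_isAlgebra.Build K extalg ext_scaleAr.

Definition extC (a : A) := ExtAlg [ffun S => if S == set0 then a else 0].
Definition extG (j : 'I_n) := ExtAlg [ffun S => (S == [set j])%:R].

Lemma extcoef_mulC a f S : extcoef (extC a * f) S = a * extcoef f S.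
Proof.
rewrite ffunE (bigD1 set0) ?sub0set //= big1 => [|T /andP[_ /negPf nT]].
  by rewrite ninv0l ffunE eqxx setD0 mul1r addr0.
by rewrite ffunE nT mul0r mulr0.
Qed.
Lemma extCC a f : extC a * f = f * extC a.
Proof.
apply/extalgP => S; rewrite extcoef_mulC ffunE (bigD1 S) //= big1 => [|T].
  by rewrite setDv ninv0r ffunE eqxx mul1r addr0 mulrC.
case/andP=> sTS nTS; rewrite ffunE setD_eq0; case: ifP => [sST|]; last by rewrite !mulr0.
by rewrite eqEsubset sTS sST in nTS.
Qed.

Fact extC_is_linear : linear extC.
Proof.
move=> c a b; apply/extalgP => S; rewrite extcoefD extcoefZ !ffunE.
by case: ifP => //; rewrite scaler0 addr0.
Qed.
Fact extC_is_monoid_morphism : monoid_morphism extC.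
Proof.
split=> [|a b]; apply/extalgP => S; first by rewrite !ffunE; case: ifP.
by rewrite extcoef_mulC !ffunE; case: ifP; rewrite ?mulr0.
Qed.
HB.instance Definition _ := GRing.isLinear.Build K A extalg *:%R extC extC_is_linear.
HB.instance Definition _ :=
  GRing.isMonoidMorphism.Build A extalg extC extC_is_monoid_morphism.

Lemma extG_mul_coef j f S :
  extcoef (extG j * f) S =
  if j \in S then (-1) ^+ (\sum_(k in S) (k < j)%N) * extcoef f (S :\ j) else 0.
Proof.
rewrite ffunE; case: ifP => jS; last first.
  rewrite big1 // => T sTS; rewrite ffunE; case: eqP => [eT|]; last by rewrite mul0r mulr0.
  by move: sTS; rewrite eT sub1set jS.
rewrite (bigD1 [set j]) ?sub1set //= big1 ?addr0 => [|T /andP[_ /negPf nT]]; last first.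
  by rewrite ffunE nT mul0r mulr0.
rewrite ffunE eqxx mul1r; congr (_ ^+ _ * _); rewrite /ninv big_set1.
by rewrite [RHS](big_setD1 j) //= ltnn add0n.
Qed.
Lemma extG_anti j k : extG j * extG k = - (extG k * extG j).
Proof.
apply/extalgP => S; rewrite extcoefN !extG_mul_coef !ffunE.
have [<-|njk] := eqVneq j k.
  case: ifP => [jS|]; last by rewrite oppr0.
  case: eqP => [/setP/(_ j)|]; first by rewrite !inE eqxx.
  by rewrite mulr0 oppr0.
have e a b : a != b -> (a \in S) && (S :\ a == [set b]) = (S == [set a; b]).
  move=> nab; apply/andP/eqP => [[aS /eqP <-]|->]; first by rewrite setD1K.
  by rewrite !inE eqxx setU1K // inE.
have e1 := e j k njk; have e2 := e k j; rewrite eq_sym setUC in e2.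
move: (e2 njk) e1 => {e2}; have [->|_] := eqVneq S [set j; k]; last first.
  by case: (j \in S); case: (k \in S) => /= e2 e1; rewrite ?e1 ?e2 ?mulr0 ?oppr0.
move=> /andP[-> ->] /andP[-> ->]; rewrite !mulr1.
rewrite !big_setU1 ?inE //= !big_set1 !ltnn addn0 add0n.
by case: (ltngtP j k) => [||/val_inj/eqP]; rewrite ?(negPf njk) //= ?opprK.
Qed.
Lemma extG_sq j : extG j * extG j = 0.
Proof.
apply/extalgP => S; rewrite extG_mul_coef !ffunE.
case: ifP => // jS; case: eqP => [/setP/(_ j)|]; last by rewrite mulr0.
by rewrite !inE eqxx.
Qed.

(* The K-linear map sending a w_S to phi a times the product of the w j, j in S,
   in increasing order (the enumeration order of 'I_n).  It is multiplicative when
   phi is central and the w j anticommute and square to 0. *)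
Section Lift.
Variables (B : algType K) (phi : {lrmorphism A -> B}) (w : 'I_n -> B).
Definition ext_lift f : B :=
  \sum_(S : {set 'I_n}) phi (extcoef f S) * \prod_(j in S) w j.

Fact ext_lift_is_linear : linear ext_lift.
Proof.
move=> c f g; rewrite /ext_lift scaler_sumr -big_split; apply: eq_bigr => S _.
by rewrite extcoefD extcoefZ linearP mulrDl -scalerAl.
Qed.
HB.instance Definition _ := GRing.isLinear.Build K extalg B *:%R ext_lift ext_lift_is_linear.

Lemma ext_liftC a : ext_lift (extC a) = phi a.
Proof.
rewrite /ext_lift (bigD1 set0) //= big_set0 ffunE eqxx mulr1 big1 ?addr0 //.
by move=> S /negPf nS; rewrite ffunE nS rmorph0 mul0r.
Qed.
Lemma ext_liftG j : ext_lift (extG j) = w j.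
Proof.
rewrite /ext_lift (bigD1 [set j]) //= big_set1 ffunE eqxx rmorph1 mul1r big1 ?addr0 //.
by move=> S /negPf nS; rewrite ffunE nS rmorph0 mul0r.
Qed.

Hypothesis phiC : forall a b, phi a * b = b * phi a.
Hypothesis wN : forall j k, w j * w k = - (w k * w j).
Hypothesis wsq : forall j, w j * w j = 0.

Lemma prodw1_seq (r : seq 'I_n) j T : sorted (fun a b : 'I_n => a < b)%N r -> j \in r ->
  w j * \prod_(k <- r | k \in T) w k =
  if j \in T then 0
  else (-1) ^+ (\sum_(k <- r | k \in T) (k < j)%N) * \prod_(k <- r | k \in j |: T) w k.
Proof.
elim: r => // k r IH sr; have sr' := path_sorted sr.
have ltkr : {in r, forall l : 'I_n, (k < l)%N}.
  apply/allP; apply: order_path_min sr => a b c; exact: ltn_trans.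
rewrite inE !big_cons !inE; have [-> _|njk /= jr] := eqVneq j k.
  case: ifP => kT; first by rewrite mulrA wsq mul0r.
  rewrite [X in (-1) ^+ X]big1_seq ?mul1r; last by move=> l /andP[_ lr]; rewrite ltnNge ltnW // ltkr.
  congr (_ * _); rewrite big_seq_cond [RHS]big_seq_cond; apply: eq_bigl => l.
  rewrite !inE; case lr: (l \in r) => //=; case: eqP => // lk.
  by move: (ltkr l lr); rewrite lk ltnn.
have ltkj := ltkr j jr.
case: ifP => kT; last by rewrite IH.
rewrite mulrA wN mulNr -mulrA IH //; case: ifP => jT; first by rewrite mulr0 oppr0.
by rewrite ltkj exprS mulN1r mulNr mulrA (commr_sign (w k)) mulrA.
Qed.

Lemma sorted_index_ord : sorted (fun a b : 'I_n => a < b)%N (index_enum 'I_n).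
Proof.
have := iota_ltn_sorted 0 n; rewrite -val_enum_ord sorted_map enumT.
by rewrite /index_enum; case: index_enum_key.
Qed.

Lemma prodw1 j T : w j * \prod_(k in T) w k =
  if j \in T then 0
  else (-1) ^+ ninv [set j] T * \prod_(k in j |: T) w k.
Proof.
by rewrite (prodw1_seq _ sorted_index_ord) ?mem_index_enum // /ninv big_set1.
Qed.

Lemma prodwM S T : \prod_(k in S) w k * \prod_(k in T) w k =
  if [disjoint S & T] then (-1) ^+ ninv S T * \prod_(k in S :|: T) w k else 0.
Proof.
have [m] := ubnP #|S|; elim: m S => // m IH S.
have [-> _|] := set_0Vmem S.
  by rewrite big_set0 mul1r -setI_eq0 set0I eqxx ninv0l mul1r set0U.
case=> j0 j0S ltm; have [j jS' jmin] := arg_minnP (P := mem S) (fun j : 'I_n => val j) j0S; have jS : j \in S := jS'.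
have eS : j |: S :\ j = S by rewrite setD1K.
have ninv0 : ninv [set j] (S :\ j) = 0%N.
  rewrite /ninv big_set1 big1 // => k; rewrite !inE => /andP[_ /jmin].
  by rewrite leqNgt => /negPf ->.
have -> : \prod_(k in S) w k = w j * \prod_(k in S :\ j) w k.
  by rewrite prodw1 !inE eqxx /= ninv0 mul1r eS.
rewrite -mulrA IH; last by move: ltm; rewrite (cardsD1 j S) jS.
have dE : [disjoint S & T] = (j \notin T) && [disjoint S :\ j & T].
  by rewrite -[in LHS]eS -!setI_eq0 setIUl setU_eq0 !setI_eq0 disjoints1.
rewrite dE; case: ifP => dS; rewrite ?andbF ?mulr0 // andbT.
have dj : [disjoint [set j] & S :\ j] by rewrite disjoints1 !inE eqxx.
rewrite mulrA (commr_sign (w j)) -mulrA prodw1 !inE eqxx /=.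
case: (boolP (j \in T)) => jT /=; first by rewrite mulr0.
rewrite mulrA -exprD setUA eS; congr (_ ^+ _ * _).
by rewrite -{3}eS ninvUl // ninvUr // ninv0 add0n addnC.
Qed.

Fact ext_lift_monoid_morphism : monoid_morphism ext_lift.
Proof.
have phiAC a b x y : phi a * x * (phi b * y) = phi a * phi b * (x * y).
  by rewrite -!mulrA; congr (_ * _); rewrite !mulrA phiC.
split=> [|f g].
  have -> : 1 = extC 1 :> extalg by rewrite rmorph1.
  by rewrite ext_liftC rmorph1.
rewrite /ext_lift mulr_suml.
under eq_bigr => U _ do rewrite ffunE rmorph_sum mulr_suml.
rewrite (exchange_big_dep predT) //=; apply: eq_bigr => S _.
rewrite mulr_sumr [RHS](bigID (fun T => [disjoint S & T])) /= [X in _ = _ + X]big1 ?addr0; last first.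
  move=> T /negPf nd; by rewrite phiAC prodwM nd mulr0.
rewrite (reindex_onto (fun T => S :|: T) (fun V => V :\: S)) /=; last first.
  move=> V sSV; apply/setP => x; rewrite !inE; move/subsetP/(_ x): sSV.
  by case: (x \in S) => // ->.
apply: eq_big => [T|T].
  rewrite subsetUl; apply/eqP/idP => [<-|/setDUl_disj //].
  by rewrite disjoint_sym disjoints_subset; apply/subsetP => x; rewrite !inE => /andP[].
move=> /andP[_ /eqP eT]; have dST : [disjoint S & T].
  rewrite -eT disjoint_sym disjoints_subset.
  by apply/subsetP => x; rewrite !inE => /andP[].
rewrite eT !rmorphM rmorph_sign /= phiAC prodwM dST [RHS]mulrA; congr (_ * _).
exact: esym (commr_sign _ _).
Qed.
End Lift.

Lemma extE f : f = \sum_(S : {set 'I_n}) extC (extcoef f S) * \prod_(j in S) extG j.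
Proof.
have prodE S U : extcoef (\prod_(j in S) extG j) U = (U == S)%:R.
  have [m] := ubnP #|S|; elim: m S U => // m IH S U.
  have [-> _|] := set_0Vmem S; first by rewrite big_set0 ffunE.
  case=> j0 j0S ltm; have [j jS' jmin] := arg_minnP (P := mem S) (fun j : 'I_n => val j) j0S; have jS : j \in S := jS'.
  have eS : j |: S :\ j = S by rewrite setD1K.
  have ninv0 : ninv [set j] (S :\ j) = 0%N.
    rewrite /ninv big_set1 big1 // => k; rewrite !inE => /andP[_ /jmin].
    by rewrite leqNgt => /negPf ->.
  have -> : \prod_(k in S) extG k = extG j * \prod_(k in S :\ j) extG k.
    by rewrite (prodw1 extG_anti extG_sq) !inE eqxx /= ninv0 mul1r eS.
  rewrite extG_mul_coef IH; last by move: ltm; rewrite (cardsD1 j S) jS.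
  case: ifP => jU; last by case: eqP => // eUS; rewrite eUS jS in jU.
  have [eUS|nUS] := eqVneq U S; last first.
    case: eqP => [eD|]; last by rewrite mulr0.
    by case/eqP: nUS; rewrite -(setD1K jU) eD eS.
  rewrite eUS eqxx mulr1 (big_setD1 j) //= ltnn add0n.
  by move: ninv0; rewrite /ninv big_set1 => ->.
apply/extalgP => U; rewrite extcoef_sum (bigD1 U) //= extcoef_mulC prodE eqxx mulr1.
rewrite big1 ?addr0 // => S nS; rewrite extcoef_mulC prodE.
by rewrite eq_sym (negPf nS) mulr0.
Qed.

Fact extG_shift_mul (a b : A) (v x y : extalg) : v * v = 0 ->
  (x + extC a * v) * (y + extC b * v) =
  x * y + extC b * (x * v) + extC a * (v * y).
Proof.
move=> vv; have aC c (z : extalg) : z * extC c = extC c * z by rewrite extCC.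
rewrite mulrDl !mulrDr -!mulrA (mulrA v) aC -!mulrA vv !mulr0 addr0.
by rewrite !mulrA aC.
Qed.
Lemma extG_shift_anti a b j k l :
  (extG j + extC a * extG l) * (extG k + extC b * extG l) =
  - ((extG k + extC b * extG l) * (extG j + extC a * extG l)).
Proof.
rewrite !extG_shift_mul ?extG_sq // (extG_anti j k) (extG_anti j) (extG_anti l k).
by rewrite !mulrN !opprD addrAC.
Qed.
Lemma extG_shift_sq a j l :
  (extG j + extC a * extG l) * (extG j + extC a * extG l) = 0.
Proof. by rewrite extG_shift_mul ?extG_sq // (extG_anti j) mulrN add0r addNr. Qed.

End ExteriorAlgebra.

(* Indices are shifted by one: i : 'I_n stands for the index i+1 of x, w and s.
   For i.+1 < n, ordS i is the successor of i; i.+1 = n is the sign change. *)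
Section PolyExt.
Variable n : nat.
Implicit Types i j k : 'I_n.

Definition Pext := extalg {mpoly rat[n]} n.

Definition px i : Pext := extC _ 'X_i.
Definition pw j : Pext := extG _ j.

Lemma px_central i (f : Pext) : px i * f = f * px i.
Proof. exact: extCC. Qed.

Definition refl_x i j : {mpoly rat[n]} :=
  if (i.+1 < n)%N then 'X_(tperm i (ordS i) j)
  else if j == i then - 'X_j else 'X_j.
Definition refl_w i j : Pext :=
  if (i.+1 < n)%N && (j == i) then pw i + (px i ^+ 2 - px (ordS i) ^+ 2) * pw (ordS i)
  else pw j.

Definition refl_poly i (p : {mpoly rat[n]}) : Pext :=
  extC _ (p \mPo [tuple refl_x i j | j < n]).
Fact refl_poly_is_linear i : linear (refl_poly i).
Proof. by move=> c p q; rewrite /refl_poly !linearP. Qed.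
Fact refl_poly_monoid_morphism i : monoid_morphism (refl_poly i).
Proof. by split=> [|p q]; rewrite /refl_poly ?rmorph1 ?rmorphM. Qed.
HB.instance Definition _ i := GRing.isLinear.Build rat {mpoly rat[n]} Pext *:%R
  (refl_poly i) (refl_poly_is_linear i).
HB.instance Definition _ i := GRing.isMonoidMorphism.Build {mpoly rat[n]} Pext
  (refl_poly i) (refl_poly_monoid_morphism i).

Definition refl i : Pext -> Pext := ext_lift (refl_poly i) (refl_w i).
HB.instance Definition _ i := GRing.Linear.on (refl i).

Lemma val_ordS i : (i.+1 < n)%N -> ordS i = i.+1 :> nat.
Proof. by move=> lt_in; rewrite /= modn_small. Qed.
Lemma ordS_neq i : (i.+1 < n)%N -> (ordS i == i) = false.
Proof. by move=> /val_ordS e; rewrite -val_eqE -[val _]/(nat_of_ord _) e gtn_eqF. Qed.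

Fact refl_wE i j : exists a, refl_w i j = pw j + extC _ a * pw (ordS i).
Proof.
rewrite /refl_w; case: ifP => [/andP[_ /eqP ->]|_].
  exists ('X_i ^+ 2 - 'X_(ordS i) ^+ 2); congr (_ + _ * _).
  by rewrite rmorphB !rmorphXn.
by exists 0; rewrite rmorph0 mul0r addr0.
Qed.

Fact refl_monoid_morphism i : monoid_morphism (refl i).
Proof.
apply: ext_lift_monoid_morphism => [a b|j k|j]; first exact: extCC.
  have [a ->] := refl_wE i j; have [b ->] := refl_wE i k.
  exact: extG_shift_anti.
have [a ->] := refl_wE i j; exact: extG_shift_sq.
Qed.
HB.instance Definition _ i :=
  GRing.isMonoidMorphism.Build Pext Pext (refl i) (refl_monoid_morphism i).

Lemma refl_px i j : refl i (px j) = extC _ (refl_x i j).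
Proof. by rewrite /refl ext_liftC /= /refl_poly comp_mpolyXU nth_mktuple. Qed.

Lemma refl_px_perm i j : (i.+1 < n)%N -> refl i (px j) = px (tperm i (ordS i) j).
Proof. by move=> lt_in; rewrite refl_px /refl_x lt_in. Qed.
Lemma refl_px_sign i j : i.+1 = n -> refl i (px j) = if j == i then - px j else px j.
Proof. by move=> e; rewrite refl_px /refl_x e ltnn; case: ifP; rewrite ?rmorphN. Qed.
Lemma refl_pw i j : refl i (pw j) = refl_w i j.
Proof. exact: ext_liftG. Qed.

Lemma Pext_hom_ext (s t : {lrmorphism Pext -> Pext}) :
  (forall j, s (px j) = t (px j)) -> (forall j, s (pw j) = t (pw j)) -> s =1 t.
Proof.
move=> sx sw f; rewrite (extE f) !linear_sum; apply: eq_bigr => S _.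
rewrite !rmorphM !rmorph_prod /=; congr (_ * _); last exact: eq_bigr.
elim/mpolyind: (extcoef f S) => [|c m p _ _ IH]; first by rewrite !rmorph0.
have CZ (q : {mpoly rat[n]}) : extC n (c *: q) = c *: extC n q by apply: linearZ_LR.
rewrite !rmorphD /= {}IH {}CZ mpolyXE_id !linearZ_LR /= !rmorph_prod /=.
congr (_ *: _ + _); apply: eq_bigr => j _; rewrite !rmorphXn /=.
by congr (_ ^+ _); apply: sx.
Qed.

Lemma reflK i : involutive (refl i).
Proof.
move=> f; have := @Pext_hom_ext (refl i \o refl i) idfun.
apply=> j /=.
  case: (ltngtP i.+1 n) (ltn_ord i) => // [lt_in|e] _.
    by rewrite !refl_px_perm // tpermK.
  by rewrite refl_px_sign //; case: ifP => ji; rewrite ?raddfN /= refl_px_sign // ji ?opprK.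
rewrite refl_pw /refl_w; case: ifP => [/andP[lt_in /eqP ->]|nij]; last first.
  by rewrite refl_pw /refl_w nij.
rewrite rmorphD rmorphM rmorphB !rmorphXn /= !refl_px_perm // !refl_pw /refl_w.
rewrite lt_in eqxx ordS_neq //= tpermL tpermR.
by rewrite -[X in _ + X * _]opprB mulNr addrK.
Qed.

(* d = (1 - s_i) / (x_i - s_i x_i), the denominator being central. *)
Definition divided_difference i (d : Pext -> Pext) :=
  forall f, (px i - refl i (px i)) * d f = f - refl i f.

Definition demazure_generators i (d : Pext -> Pext) :=
  if (i.+1 < n)%N then
    [/\ d (px i) = 1, d (px (ordS i)) = -1,
        forall j, j != i -> j != ordS i -> d (px j) = 0
      & forall j, d (pw j) =
                  if j == i then - ((px i + px (ordS i)) * pw (ordS i)) else 0]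
  else
    (forall j, d (px j) = (j == i)%:R) /\ (forall j, d (pw j) = 0).

Definition twisted_leibniz i (d : Pext -> Pext) :=
  forall f g, d (f * g) = d f * g + refl i f * d g.

Definition demazure_relations (D : 'I_n -> Pext -> Pext) :=
  [/\ forall i, D i \o D i =1 fun=> 0,
      forall i j, (i.+1 < j)%N || (j.+1 < i)%N -> D i \o D j =1 D j \o D i,
      forall i j, i.+1 = j -> (j.+1 < n)%N ->
        D i \o D j \o D i =1 D j \o D i \o D j
    & forall i j, i.+1 = j -> j.+1 = n ->
        D i \o D j \o D i \o D j =1 D j \o D i \o D j \o D i].

End PolyExt.

(* Main.v *)
(* Every f - s_i f is divisible by the root a_i = x_i - s_i x_i, because this
   property holds for the generators and passes to products by the twisted Leibniz
   rule; a_i is central and not a zero divisor, so the quotient D_i f is unique.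
   For the relations, multiplying a composite of D_i and D_j attached to a
   rank-two system by the product of the positive roots yields the alternating
   sum of the reflections applied to f, which is unchanged when i and j are
   exchanged, by the braid relations between s_i and s_j. *)
From HB Require Import structures.
Require Import Defs.
From mathcomp Require Import all_boot all_order all_fingroup all_algebra.
From mathcomp Require Import mpoly.
Set Implicit Arguments.
Unset Strict Implicit.
Unset Printing Implicit Defensive.
Import GRing.Theory.
Local Open Scope ring_scope.

(* [d = (1 - s) / a] for a reflection [s] with root [a]. *)
Record quotient_by_root (R : nzRingType) (s : {rmorphism R -> R}) (a : R)
    (d : R -> R) : Prop := QuotientByRoot {
  root_central : forall x, a * x = x * a;
  lreg_root : GRing.lreg a;
  root_anti : s a = - a;
  reflection_inv : involutive s;
  mul_root : forall x, a * d x = x - s x }.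

(** * Divided differences for a single reflection *)

Section OneRoot.
Variables (R : nzRingType) (s : {rmorphism R -> R}) (a : R) (d : R -> R).
Hypothesis dP : quotient_by_root s a d.

Lemma quotient_unique x y : a * y = x - s x -> y = d x.
Proof. by rewrite -(mul_root dP) => /(lreg_root dP). Qed.

(** Applying [s] to [a * d x = x - s x] changes the sign of both [a] and the right-hand side, so
    [s (d x)] is again a quotient of [x - s x] by [a]. *)
Lemma reflection_quotient x : s (d x) = d x.
Proof.
apply: quotient_unique; apply: oppr_inj.
by rewrite -mulNr -(root_anti dP) -rmorphM (mul_root dP) rmorphB (reflection_inv dP) opprB.
Qed.

Lemma quotient_sq x : d (d x) = 0.
Proof. by apply/esym/quotient_unique; rewrite reflection_quotient subrr mulr0. Qed.

Lemma morph_quotient (t : {rmorphism R -> R}) b x :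
  t a = b -> b * t (d x) = t x - t (s x).
Proof. by move<-; rewrite -rmorphM (mul_root dP) rmorphB. Qed.

Lemma morph_root_central (t : {rmorphism R -> R}) x :
  involutive t -> t a * x = x * t a.
Proof. by move=> tK; rewrite -[x]tK -!rmorphM (root_central dP). Qed.

Lemma morph_lreg_root (t : {rmorphism R -> R}) :
  involutive t -> GRing.lreg (t a).
Proof.
move=> tK x y /(congr1 t); rewrite !rmorphM tK => /(lreg_root dP).
exact: (can_inj tK).
Qed.

End OneRoot.

(** * Composites for rank-two systems, multiplied by all positive roots *)

Section TwoRoots.
Variables (R : nzRingType) (s t : {rmorphism R -> R}) (a b : R) (ds dt : R -> R).
Hypotheses (dsP : quotient_by_root s a ds) (dtP : quotient_by_root t b dt).

Lemma quotient2 x : s b = b ->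
  b * (a * ds (dt x)) = (x - t x) - (s x - s (t x)).
Proof.
by move=> sb; rewrite (mul_root dsP) mulrBr (mul_root dtP) (morph_quotient dtP).
Qed.

(** Type A2, with positive roots [a], [b], [p]; the right-hand side is the alternating sum over the
    dihedral group of order six. *)
Lemma quotient3 p x : p = a + b -> s b = p -> t a = p ->
  p * (b * (a * ds (dt (ds x)))) =
  (x - s x) - (t x - t (s x)) + (s (t x) - s (t (s x))).
Proof.
move=> pE sb ta; set u := ds x; set v := dt u.
have sp : s p = b by rewrite -sb (reflection_inv dsP).
have Etu : p * t u = t x - t (s x) := morph_quotient dsP x ta.
have Estu : b * s (t u) = s (t x) - s (t (s x)) by rewrite -sp -rmorphM Etu rmorphB.
have Esv : p * s v = u - s (t u).
  by rewrite (morph_quotient dtP u sb) [s u](reflection_quotient dsP).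
have pb : p * b = b * p by rewrite (root_central dtP).
rewrite (mul_root dsP) 2!mulrBr (mul_root dtP) [p * (b * s v)]mulrA.
(* Splitting [p * u] as [a * u + b * u] gives [x - s x] from the first summand; the second cancels
   the [b * u] coming from [Esv]. *)
rewrite pb -mulrA Esv !mulrBr Etu pE mulrDl (mul_root dsP) Estu !opprB.
by rewrite !addrA [LHS](ACl (1*2*4*5*6*7*(3*8))) /= subrr addr0.
Qed.

(* In type B2 the positive roots are a, b, p = t a and q = s b; m and k below are
   the absolute values of the off-diagonal Cartan integers, and p *+ m = q + b
   expresses m * k = 2. *)
Lemma quotient4 p q m x : s b = q -> t a = p -> s p = p -> t q = q ->
    q = b + a *+ m -> p *+ m = q + b ->
  p * (q * (b * (a * ds (dt (ds (dt x)))))) =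
  (x - t x) - (s x - s (t x)) + (t (s x) - t (s (t x)))
  - (s (t (s x)) - s (t (s (t x)))).
Proof.
move=> sb ta sp tq qE pm.
set u := dt x; set v := ds u; set w := dt v.
have sq : s q = b by rewrite -sb (reflection_inv dsP).
have Esu : q * s u = s x - s (t x) := morph_quotient dtP x sb.
have Etsu : q * t (s u) = t (s x) - t (s (t x)) by rewrite -[in LHS]tq -rmorphM Esu rmorphB.
have Estsu : b * s (t (s u)) = s (t (s x)) - s (t (s (t x))).
  by rewrite -sq -rmorphM Etsu rmorphB.
have Etv : p * t v = u - t (s u).
  by rewrite (morph_quotient dsP u ta) [t u](reflection_quotient dtP).
have Estv : p * s (t v) = s u - s (t (s u)) by rewrite -[in LHS]sp -rmorphM Etv rmorphB.
have Esw : q * s w = v - s (t v).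
  by rewrite (morph_quotient dtP v sb) [s v](reflection_quotient dsP).
have pC y : p * y = y * p.
  by rewrite -ta (morph_root_central dsP) //; apply: reflection_inv dtP.
have pq y : p * (q * y) = q * (p * y) by rewrite !mulrA pC.
have pb y : p * (b * y) = b * (p * y) by rewrite !mulrA pC.
have qb y : q * (b * y) = b * (q * y) by rewrite !mulrA (root_central dtP).
rewrite (mul_root dsP) mulrBr (mul_root dtP) mulrBr qb Esw.
(* Since [q - b = a *+ m], the terms in [v] combine into a multiple of [a * v], which is
   [u - s u]. *)
have -> : q * (v - t v) - b * (v - s (t v)) = (a *+ m) * v - q * t v + b * s (t v).
  rewrite !mulrBr {1}qE mulrDl opprB !addrA.
  by rewrite [LHS](ACl (2*3*4*(1*5))) /= subrr addr0.
rewrite mulrDr mulrBr pq pb Etv Estv.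
(* The factor [m] moves from [a] to [p], where [p *+ m = q + b] makes the roots [q] and [b]
   available to act on [u] and [s u]. *)
have -> : p * (a *+ m * v) = (q + b) * (u - s u).
  by rewrite -pm -(mul_root dsP) !mulrnAl mulrnAr.
(* Both [q * u] and [b * s u] cancel; [b * u], [q * s u], [q * t (s u)] and [b * s (t (s u))]
   survive and carry the eight terms. *)
rewrite mulrDl !mulrBr Etsu Estsu (mul_root dtP) !opprB !addrA.
by rewrite [LHS](ACl (3*4*2*6*7*10*11*(1*8)*(5*9))) /= subrr addNr !addr0 Esu !opprB !addrA.
Qed.

End TwoRoots.

(** * Commutation and braid relations for abstract quotients *)

Section Relations.
Variables (R : nzRingType) (s t : {rmorphism R -> R}) (a b : R) (ds dt : R -> R).
Hypotheses (dsP : quotient_by_root s a ds) (dtP : quotient_by_root t b dt).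

Lemma quotientC x : s b = b -> t a = a -> s (t x) = t (s x) ->
  ds (dt x) = dt (ds x).
Proof.
move=> sb ta st; apply: (lreg_root dsP); apply: (lreg_root dtP).
rewrite (quotient2 dsP dtP) // [RHS]mulrA -(root_central dsP) -mulrA.
by rewrite (quotient2 dtP dsP) // st !opprB !addrA [LHS](ACl (1*4*3*2)).
Qed.

Lemma quotient_braid3 x : s b = a + b -> t a = a + b ->
    s (t (s x)) = t (s (t x)) ->
  ds (dt (ds x)) = dt (ds (dt x)).
Proof.
move=> sb ta sts; apply: (lreg_root dsP); apply: (lreg_root dtP).
apply: (morph_lreg_root dsP (t := t) (reflection_inv dtP)); rewrite ta.
rewrite (quotient3 dsP dtP) // [b * (a * _)]mulrA -(root_central dsP) -mulrA.
rewrite (quotient3 dtP dsP x (addrC a b) ta sb) sts !opprB !addrA.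
by rewrite [LHS](ACl (1*4*5*2*3*6)).
Qed.

(** The hypotheses are stable under exchanging [s], [a], [p], [m] with [t], [b], [q], [k], so
    [quotient4] applies to both composites with the same product of roots. *)
Lemma quotient_braid4 p q m k x : s b = q -> t a = p -> s p = p -> t q = q ->
    q = b + a *+ m -> p *+ m = q + b -> p = a + b *+ k -> q *+ k = p + a ->
    s (t (s (t x))) = t (s (t (s x))) ->
  ds (dt (ds (dt x))) = dt (ds (dt (ds x))).
Proof.
move=> sb ta sp tq qE pm pE qk stst.
have p_reg : GRing.lreg p.
  by rewrite -ta; apply: (morph_lreg_root dsP) (reflection_inv dtP).
have q_reg : GRing.lreg q.
  by rewrite -sb; apply: (morph_lreg_root dtP) (reflection_inv dsP).
apply: (lreg_root dsP); apply: (lreg_root dtP); apply: q_reg; apply: p_reg.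
rewrite (quotient4 dsP dtP x sb ta sp tq qE pm).
have pC y : p * y = y * p.
  by rewrite -ta (morph_root_central dsP) //; apply: reflection_inv dtP.
rewrite [p * (q * _)]mulrA pC [b * (a * _)]mulrA -(root_central dsP) -!mulrA.
rewrite (quotient4 dtP dsP x ta sb tq sp pE qk) stst !opprB !addrA.
by rewrite [LHS](ACl (1*4*5*2*3*8*7*6)).
Qed.

End Relations.

(** * Rank-two relations between reflections, on abstract generators *)

(** Here [x], [y], [z] stand for squares of consecutive variables and [u], [v], [w] for the matching
    exterior generators. Both sides give [u + (x - z) * v + (x - z) * (y - z) * w], respectively
    [v + (x - z) * w]; the first needs the two coefficients to commute. *)
Lemma braid3_shift (R : nzRingType) (s t : {rmorphism R -> R}) (x y z u v w : R) :
    GRing.comm (x - z) (y - z) ->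
    s x = y -> s y = x -> s z = z -> t x = x -> t y = z -> t z = y ->
    s u = u + (x - y) * v -> s v = v -> s w = w ->
    t u = u -> t v = v + (y - z) * w -> t w = w ->
  s (t (s u)) = t (s (t u)) /\ s (t (s v)) = t (s (t v)).
Proof.
move=> xyz sx sy sz tx ty tz su sv sw tu tv tw.
do 8! rewrite ?(su, sv, sw, tu, tv, tw, sx, sy, sz, tx, ty, tz,
                rmorphD, rmorphM, rmorphB, rmorphN) /=.
split.
  rewrite !mulrDr !mulrA xyz !addrA; congr (_ + _); rewrite -!addrA -mulrDl.
  by rewrite addrA subrK.
rewrite -!addrA -!mulrDl; congr (_ + _ * _).
by rewrite [RHS]addrC addrA subrK.
Qed.

Lemma braid4_sign (R : nzRingType) (s t : {rmorphism R -> R}) (x y : R) :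
    s x = y -> s y = x -> t x = x -> t y = - y ->
  s (t (s (t x))) = t (s (t (s x))) /\ s (t (s (t y))) = t (s (t (s y))).
Proof.
by move=> sx sy tx ty; split; do 6! rewrite ?(sx, sy, tx, ty, rmorphN) /=.
Qed.

(** Both sides collapse to [u]. This serves the exterior generators, whose shifts involve only
    squares of variables and so are fixed by the sign change [t]. *)
Lemma braid4_shift (R : Type) (s t : R -> R) (u : R) :
  involutive s -> t u = u -> t (s u) = s u -> s (t (s (t u))) = t (s (t (s u))).
Proof. by move=> sK tu tsu; rewrite tu tsu sK tu. Qed.

Lemma comm_shift (R : nzRingType) (s t : {rmorphism R -> R}) (x y u v : R) :
    t x = x -> t y = y -> t u = u -> t v = v -> s u = u + (x ^+ 2 - y ^+ 2) * v ->
  s (t u) = t (s u).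
Proof.
move=> tx ty tu tv su.
by rewrite tu su !(rmorphD, rmorphM, rmorphN, rmorphXn) /= tx ty tu tv.
Qed.

Lemma extC_lreg (K : comNzRingType) (A : comAlgType K) n (a : A) :
  GRing.lreg a -> GRing.lreg (extC n a).
Proof.
move=> rega f g /extalgP efg; apply/extalgP => S.
by apply: rega; rewrite -!extcoef_mulC efg.
Qed.

(** * Induction on generators, and the simple roots *)

Section Demazure.
Variable n : nat.
Implicit Types (i j k : 'I_n) (f g h : Pext n).

Local Notation C := (@extC rat {mpoly rat[n]} n).

(** Each element is a sum of products of a polynomial coefficient and exterior generators; the
    coefficient is in turn built from scaled monomials, which the single clause for [c *: f + g]
    covers. *)
Lemma Pext_ind (P : Pext n -> Prop) :
    (forall c f g, P f -> P g -> P (c *: f + g)) ->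
    P 1 -> (forall f g, P f -> P g -> P (f * g)) ->
    (forall j, P (px j)) -> (forall j, P (pw j)) -> forall f, P f.
Proof.
move=> PD P1 PM Px Pw f.
have P0 : P 0 by rewrite -(addNr 1) -scaleN1r; apply: PD.
rewrite (extE f); apply: (big_ind P) => // [g h Pg Ph|S _].
  by rewrite -[g]scale1r; apply: PD.
apply: (PM _ _); last by apply: (big_ind P P1 PM) => j _; apply: Pw.
elim/mpolyind: (extcoef f S) => [|c m p _ _ IH]; first by rewrite rmorph0.
have -> : C (c *: 'X_[m] + p) = c *: C 'X_[m] + C p by apply: linearP.
apply: PD => //; rewrite mpolyXE_id rmorph_prod.
apply: (big_ind P P1 PM) => j _; rewrite rmorphXn /=.
by elim: (m j) => [|e IHe]; rewrite ?expr0 // exprS; apply: PM => //; apply: Px.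
Qed.

Definition simple_root i : {mpoly rat[n]} := 'X_i - refl_x i i.

Lemma extC_root i : C (simple_root i) = px i - refl i (px i).
Proof. by rewrite refl_px rmorphB. Qed.

Lemma extC_root_lt i : (i.+1 < n)%N -> C (simple_root i) = px i - px (ordS i).
Proof. by move=> lt_in; rewrite extC_root refl_px_perm // tpermL. Qed.

Lemma extC_root_last i : i.+1 = n -> C (simple_root i) = px i *+ 2.
Proof. by move=> e; rewrite extC_root refl_px_sign // eqxx opprK. Qed.

Lemma root_neq0 i : simple_root i != 0.
Proof.
(* At the point with [i]-th coordinate 1 and all others 0, the root takes the value 1, or 2 for the
   sign change. *)
apply/eqP => /(congr1 (meval (fun k => (k == i)%:R))); apply/eqP.
rewrite /simple_root /refl_x mevalB mevalXU eqxx; case: ifP => [lt_in|_].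
  by rewrite tpermL mevalXU ordS_neq // subr0 meval0 oner_eq0.
by rewrite mevalN mevalXU eqxx opprK meval0.
Qed.

Lemma root_lreg i : GRing.lreg (C (simple_root i)).
Proof. by apply: extC_lreg; apply/lregP/root_neq0. Qed.

Lemma refl_root i : refl i (C (simple_root i)) = - C (simple_root i).
Proof. by rewrite extC_root rmorphB /= reflK opprB. Qed.

(** * Existence of the quotients and construction of the operators *)

Definition demazure_x i j : Pext n :=
  if (i.+1 < n)%N then (j == i)%:R - (j == ordS i)%:R else (j == i)%:R.
Definition demazure_w i j : Pext n :=
  if (i.+1 < n)%N && (j == i) then - ((px i + px (ordS i)) * pw (ordS i)) else 0.

Lemma root_demazure_x i j : C (simple_root i) * demazure_x i j = px j - refl i (px j).
Proof.
rewrite /demazure_x; case: (ltngtP i.+1 n) (ltn_ord i) => // [lt_in|e] _.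
  rewrite extC_root_lt // refl_px_perm //; case: tpermP => [->|->|].
  - by rewrite eqxx eq_sym ordS_neq // subr0 mulr1.
  - by rewrite eqxx ordS_neq // sub0r mulrN1 opprB.
  - by move=> /eqP/negPf-> /eqP/negPf->; rewrite !subrr mulr0.
rewrite extC_root_last // refl_px_sign //; case: eqP => [->|_].
  by rewrite mulr1 opprK.
by rewrite mulr0 subrr.
Qed.

Lemma root_demazure_w i j : C (simple_root i) * demazure_w i j = pw j - refl i (pw j).
Proof.
rewrite refl_pw /refl_w /demazure_w; case: ifP => [/andP[lt_in /eqP ->]|_].
  rewrite extC_root_lt // opprD addNKr mulrN mulrA /px.
  (* The difference of squares is factored among polynomials, where multiplication is commutative,
     and then carried over by [extC]. *)
  by rewrite -!rmorphXn -rmorphD -!rmorphB -rmorphM -subr_sqr.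
by rewrite mulr0 subrr.
Qed.

(** Centrality lets the root pass [refl i f]; the two terms [refl i f * g] then cancel. *)
Lemma twisted_leibniz_root i f g f' g' :
  C (simple_root i) * f' = f - refl i f -> C (simple_root i) * g' = g - refl i g ->
  C (simple_root i) * (f' * g + refl i f * g') = f * g - refl i (f * g).
Proof.
move=> Df Dg; rewrite rmorphM /= mulrDr mulrA Df mulrA extCC -mulrA Dg.
by rewrite mulrBl mulrBr addrA subrK.
Qed.

(** Boolean equality makes the existence usable by [xchoose], which turns it into a function. *)
Lemma demazure_ex i f : exists g, C (simple_root i) * g == f - refl i f.
Proof.
elim/Pext_ind: f => [c f g [f' /eqP Df] [g' /eqP Dg]||f g [f' /eqP Df] [g' /eqP Dg]|j|j].
- exists (c *: f' + g'); apply/eqP.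
  by rewrite mulrDr -scalerAr Df Dg linearP /= scalerBr opprD addrACA.
- by exists 0; rewrite mulr0 rmorph1 subrr.
- exists (f' * g + refl i f * g'); apply/eqP; exact: (twisted_leibniz_root Df Dg).
- by exists (demazure_x i j); apply/eqP/root_demazure_x.
- by exists (demazure_w i j); apply/eqP/root_demazure_w.
Qed.

Fact demazure_sig i f : {g | C (simple_root i) * g = f - refl i f}.
Proof. by exists (xchoose (demazure_ex i f)); exact/eqP/(xchooseP (demazure_ex i f)). Qed.

Definition demazure_fun i f : Pext n := sval (demazure_sig i f).

Lemma demazure_funE i f : C (simple_root i) * demazure_fun i f = f - refl i f.
Proof. exact: svalP (demazure_sig i f). Qed.

Fact demazure_is_linear i : linear (demazure_fun i).
Proof.
move=> c f g; apply: (root_lreg (i := i)).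
rewrite demazure_funE mulrDr demazure_funE -scalerAr.
have -> := demazure_funE i f.
by rewrite linearP /= scalerBr opprD addrACA.
Qed.
HB.instance Definition _ i := GRing.isLinear.Build rat (Pext n) (Pext n) *:%R
  (demazure_fun i) (demazure_is_linear i).

Definition demazure i : {linear Pext n -> Pext n} := demazure_fun i.

Lemma demazureE i f : C (simple_root i) * demazure i f = f - refl i f.
Proof. exact: demazure_funE. Qed.

(** * Characterizations by division and by the Leibniz rule *)

Lemma demazure_unique i f g : C (simple_root i) * g = f - refl i f -> g = demazure i f.
Proof. by rewrite -demazureE => /root_lreg. Qed.

Lemma divided_differenceP i (d : Pext n -> Pext n) :
  divided_difference i d <-> d =1 demazure i.
Proof.
rewrite /divided_difference -extC_root.
by split=> [dd f|dE f]; [apply: demazure_unique | rewrite dE demazureE].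
Qed.

Lemma demazure_generatorsP i (d : Pext n -> Pext n) : demazure_generators i d <->
  (forall j, d (px j) = demazure_x i j) /\ (forall j, d (pw j) = demazure_w i j).
Proof.
rewrite /demazure_generators /demazure_x /demazure_w; case: ifP => //= lt_in.
have neq := ordS_neq lt_in; split=> [[di dS dj dw]|[dx dw]].
  split=> // j; have [->|ji] := eqVneq j i.
    by rewrite di eq_sym neq subr0.
  by have [->|jS] := eqVneq j (ordS i); rewrite ?dS ?sub0r // dj // oppr0.
split=> // [||j ji jS]; rewrite dx.
- by rewrite eqxx eq_sym neq subr0.
- by rewrite eqxx neq sub0r.
- by rewrite (negPf ji) (negPf jS) subrr.
Qed.

Lemma demazure_leibniz i : twisted_leibniz i (demazure i).
Proof.
by move=> f g; apply/esym/demazure_unique/twisted_leibniz_root; rewrite demazureE.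
Qed.

Lemma twisted_leibniz_ext i (d d' : {linear Pext n -> Pext n}) :
    twisted_leibniz i d -> twisted_leibniz i d' ->
    (forall j, d (px j) = d' (px j)) -> (forall j, d (pw j) = d' (pw j)) ->
  d =1 d'.
Proof.
(* The Leibniz rule at [1 * 1] reads [e 1 = e 1 + e 1]. *)
have d1 (e : {linear Pext n -> Pext n}) : twisted_leibniz i e -> e 1 = 0.
  move=> /(_ 1 1); rewrite rmorph1 !mul1r mulr1 => /eqP.
  by rewrite -[X in X == _]addr0 (inj_eq (addrI _)) eq_sym => /eqP.
move=> dM d'M dx dw; elim/Pext_ind => // [c f g IHf IHg||f g IHf IHg].
- by rewrite !linearP IHf IHg.
- by rewrite !d1.
- by rewrite dM d'M IHf IHg.
Qed.

Lemma demazure_twisted_leibnizP i (d : {linear Pext n -> Pext n}) :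
  demazure_generators i d /\ twisted_leibniz i d <-> d =1 demazure i.
Proof.
have Dx j : demazure i (px j) = demazure_x i j.
  exact/esym/demazure_unique/root_demazure_x.
have Dw j : demazure i (pw j) = demazure_w i j.
  exact/esym/demazure_unique/root_demazure_w.
rewrite demazure_generatorsP; split=> [[[dx dw] dM]|dE].
  by apply: (twisted_leibniz_ext dM (@demazure_leibniz i)) => j; rewrite ?dx ?dw.
split; first by split=> j; rewrite dE.
by move=> f g; rewrite !dE demazure_leibniz.
Qed.

Lemma demazure_quotient i :
  quotient_by_root (refl i) (C (simple_root i)) (demazure i).
Proof.
split=> [f||| |f].
- exact: extCC.
- exact: root_lreg.
- exact: refl_root.
- exact: reflK.
- exact: demazureE.
Qed.

(** * Values of the simple reflections on generators *)

Lemma ordS_eq i j : i.+1 = j -> ordS i = j.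
Proof. by move=> ij; apply: val_inj; rewrite /= ij modn_small. Qed.

Lemma succ_ordP i : {j : 'I_n | i.+1 = j} + {i.+1 = n}.
Proof.
case: (ltngtP i.+1 n) (ltn_ord i) => // [lt_in|e] _; last by right.
by left; exists (Ordinal lt_in).
Qed.

Lemma refl_pxL i j : i.+1 = j -> refl i (px i) = px j.
Proof. by move=> ij; rewrite refl_px_perm ?ij // tpermL (ordS_eq ij). Qed.

Lemma refl_pxR i j : i.+1 = j -> refl i (px j) = px i.
Proof. by move=> ij; rewrite refl_px_perm ?ij // -(ordS_eq ij) tpermR. Qed.

Lemma refl_pxN i : i.+1 = n -> refl i (px i) = - px i.
Proof. by move=> e; rewrite refl_px_sign // eqxx. Qed.

Lemma refl_pxD i j : j != i -> j != i.+1 :> nat -> refl i (px j) = px j.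
Proof.
move=> ji jSi; case: (ltngtP i.+1 n) (ltn_ord i) => // [lt_in|e] _.
  rewrite refl_px_perm // tpermD // eq_sym //.
  by rewrite -val_eqE [val (ordS i)]val_ordS.
by rewrite refl_px_sign // (negPf ji).
Qed.

Lemma refl_pwL i j : i.+1 = j ->
  refl i (pw i) = pw i + (px i ^+ 2 - px j ^+ 2) * pw j.
Proof. by move=> ij; rewrite refl_pw /refl_w ij ltn_ord eqxx (ordS_eq ij). Qed.

Lemma refl_pwN i j : i.+1 = n -> refl i (pw j) = pw j.
Proof. by move=> e; rewrite refl_pw /refl_w e ltnn. Qed.

Lemma refl_pwD i j : j != i -> refl i (pw j) = pw j.
Proof. by move=> ji; rewrite refl_pw /refl_w (negPf ji) andbF. Qed.

Lemma px_sqB_comm i j k l :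
  (px i ^+ 2 - px j ^+ 2) * (px k ^+ 2 - px l ^+ 2) =
  (px k ^+ 2 - px l ^+ 2) * (px i ^+ 2 - px j ^+ 2).
Proof. by rewrite /px -!rmorphXn -!rmorphB extCC. Qed.

(** * Braid and commutation relations between the reflections *)

Lemma refl_braid3 i j f : i.+1 = j -> (j.+1 < n)%N ->
  refl i (refl j (refl i f)) = refl j (refl i (refl j f)).
Proof.
move=> ij lt_jn; pose k := Ordinal lt_jn; have jk : j.+1 = k by [].
have ji : j != i by rewrite -val_eqE /= -ij gtn_eqF.
have kj : k != j by rewrite -val_eqE /= gtn_eqF.
have ki : k != i by rewrite -val_eqE /= -ij gtn_eqF // ltnS leqW.
have kSi : k != i.+1 :> nat by rewrite ij.
have iSj : i != j.+1 :> nat by rewrite -ij ltn_eqF // ltnS leqW.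
have ik : refl j (px i) = px i by rewrite refl_pxD // eq_sym.
have ki' : refl i (px k) = px k by rewrite refl_pxD.
have iw : refl j (pw i) = pw i by rewrite refl_pwD // eq_sym.
have jw : refl i (pw j) = pw j by rewrite refl_pwD.
have kwi : refl i (pw k) = pw k by rewrite refl_pwD.
have kwj : refl j (pw k) = pw k by rewrite refl_pwD.
pose E := (refl_pxL ij, refl_pxR ij, refl_pxL jk, refl_pxR jk, ik, ki').
move: f; apply: (@Pext_hom_ext n (refl i \o refl j \o refl i) (refl j \o refl i \o refl j)).
  move=> l /=; have [->|li] := eqVneq l i; first by rewrite !E.
  have [->|lj] := eqVneq l j; first by rewrite !E.
  have [->|lk] := eqVneq l k; first by rewrite !E.
  have Il : refl i (px l) = px l by rewrite refl_pxD // ij val_eqE.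
  have Jl : refl j (px l) = px l by rewrite refl_pxD // jk val_eqE.
  by rewrite Il Jl Il Jl.
have sq (s : {rmorphism Pext n -> Pext n}) a b : s (px a) = px b -> s (px a ^+ 2) = px b ^+ 2.
  by move=> sab; rewrite rmorphXn sab.
have B := braid3_shift (px_sqB_comm i k j k)
  (sq (refl i) _ _ (refl_pxL ij)) (sq (refl i) _ _ (refl_pxR ij)) (sq (refl i) _ _ ki')
  (sq (refl j) _ _ ik) (sq (refl j) _ _ (refl_pxL jk)) (sq (refl j) _ _ (refl_pxR jk))
  (refl_pwL ij) jw kwi iw (refl_pwL jk) kwj.
move=> l /=; have [->|li] := eqVneq l i; first exact: B.1.
have [->|lj] := eqVneq l j; first exact: B.2.
(* This case includes [l = k]: the reflection with index [j] shifts only [pw j]. *)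
have Il : refl i (pw l) = pw l by rewrite refl_pwD.
have Jl : refl j (pw l) = pw l by rewrite refl_pwD.
by rewrite Il Jl Il Jl.
Qed.

Lemma refl_braid4 i j f : i.+1 = j -> j.+1 = n ->
  refl i (refl j (refl i (refl j f))) = refl j (refl i (refl j (refl i f))).
Proof.
move=> ij e.
have ji : j != i by rewrite -val_eqE /= -ij gtn_eqF.
have iSj : i != j.+1 :> nat by rewrite -ij ltn_eqF // ltnS leqW.
have ix : refl j (px i) = px i by rewrite refl_pxD // eq_sym.
have [[iL iR] jN] := (refl_pxL ij, refl_pxR ij, refl_pxN e).
move: f; apply: (@Pext_hom_ext n (refl i \o refl j \o refl i \o refl j)
                                 (refl j \o refl i \o refl j \o refl i)).
  have B := braid4_sign iL iR ix jN.
  move=> l; have [->|li] := eqVneq l i; first exact: B.1.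
  have [->|lj] := eqVneq l j; first exact: B.2.
  have Il : refl i (px l) = px l by rewrite refl_pxD // ij val_eqE.
  have Jl : refl j (px l) = px l by rewrite refl_px_sign // (negPf lj).
  by rewrite /= Jl Il Jl Il Jl.
have jw l : refl j (pw l) = pw l by apply: refl_pwN.
(* The shift of [pw i] contains [px j] only squared, so the sign change leaves it alone. *)
have tsw l : refl j (refl i (pw l)) = refl i (pw l).
  have [->|li] := eqVneq l i; last by rewrite refl_pwD.
  rewrite (refl_pwL ij) (rmorphD (refl j)) (rmorphM (refl j)) (rmorphB (refl j)).
  by rewrite !(rmorphXn (refl j)) /= !jw ix jN sqrrN.
by move=> l; apply: (braid4_shift (reflK i) (jw l) (tsw l)).
Qed.

Lemma reflC i j f : (i.+1 < j)%N -> refl i (refl j f) = refl j (refl i f).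
Proof.
move=> lt_ij; have lt_in : (i.+1 < n)%N by apply: ltn_trans lt_ij _.
pose i' := Ordinal lt_in; have ii' : i.+1 = i' by [].
have ij : i != j by rewrite -val_eqE /= ltn_eqF // ltnW.
have i'j : i' != j by rewrite -val_eqE /= ltn_eqF.
have ji' : j != i' by rewrite eq_sym.
have ji : j != i by rewrite eq_sym.
have iSj : i != j.+1 :> nat by rewrite ltn_eqF // ltnS ltnW // ltnW.
have i'Sj : i' != j.+1 :> nat by rewrite ltn_eqF // ltnS ltnW.
have jx : refl j (px i) = px i by rewrite refl_pxD.
have jx' : refl j (px i') = px i' by rewrite refl_pxD.
(* The bound [j <= l] covers [j] and, when it exists, its successor. *)
have ix (l : 'I_n) : (j <= l)%N -> refl i (px l) = px l.
  move=> jl; have lt_il := leq_trans lt_ij jl.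
  by rewrite refl_pxD // -?val_eqE /= gtn_eqF // ltnW.
have iw (l : 'I_n) : (j <= l)%N -> refl i (pw l) = pw l.
  by move=> jl; rewrite refl_pwD // -val_eqE /= gtn_eqF // (leq_trans (ltnW lt_ij)).
move: f; apply: (@Pext_hom_ext n (refl i \o refl j) (refl j \o refl i)).
  move=> l /=; have [->|li] := eqVneq l i; first by rewrite jx (refl_pxL ii') jx'.
  have [->|li'] := eqVneq l i'; first by rewrite jx' (refl_pxR ii') jx.
  have il : refl i (px l) = px l by rewrite refl_pxD // ii' val_eqE.
  rewrite il; have [->|lj] := eqVneq l j.
    have [[j' jj']|e] := succ_ordP j.
      by rewrite (refl_pxL jj') ix // -jj' leqnSn.
    by rewrite (refl_pxN e) (rmorphN (refl i)) /= ix.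
  have [lj'|lj'] := eqVneq (l : nat) j.+1.
    by rewrite (refl_pxR (esym lj')) ix.
  by rewrite refl_pxD.
move=> l; have [->|li] := eqVneq l i.
  by apply: (comm_shift jx jx' _ _ (refl_pwL ii')); rewrite /= refl_pwD.
have il := refl_pwD li; have [->|lj] := eqVneq l j; last first.
  by rewrite /= (refl_pwD lj) il (refl_pwD lj).
have [[j' jj']|e] := succ_ordP j; last by rewrite /= (refl_pwN _ e) iw // (refl_pwN _ e).
have jj : (j <= j')%N by rewrite -jj' leqnSn.
exact/esym/(comm_shift (ix j _) (ix j' _) (iw j _) (iw j' _) (refl_pwL jj')).
Qed.

(** * Relations between the Demazure operators *)

Lemma extC_rootB i j : i.+1 = j -> C (simple_root i) = px i - px j.
Proof. by move=> ij; rewrite extC_root (refl_pxL ij). Qed.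

(** Assuming commutation at [px j] treats a transposition and the sign change at index [j] alike. *)
Lemma refl_root_comm i j : refl i (px j) = px j ->
  refl i (refl j (px j)) = refl j (refl i (px j)) ->
  refl i (C (simple_root j)) = C (simple_root j).
Proof. by move=> ij e; rewrite extC_root (rmorphB (refl i)) /= e ij. Qed.

Lemma demazureC i j f : (i.+1 < j)%N ->
  demazure i (demazure j f) = demazure j (demazure i f).
Proof.
move=> lt_ij; have ix : refl i (px j) = px j.
  by rewrite refl_pxD // -?val_eqE /= gtn_eqF // ltnW.
have jx : refl j (px i) = px i.
  by rewrite refl_pxD // -?val_eqE /= ltn_eqF // ltnW // ltnW.
apply: (quotientC (demazure_quotient i) (demazure_quotient j)).
- exact: refl_root_comm ix (reflC _ lt_ij).
- exact: refl_root_comm jx (esym (reflC _ lt_ij)).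
- exact: reflC.
Qed.

Lemma demazure_braid3 i j f : i.+1 = j -> (j.+1 < n)%N ->
  demazure i (demazure j (demazure i f)) = demazure j (demazure i (demazure j f)).
Proof.
move=> ij lt_jn; pose k := Ordinal lt_jn; have jk : j.+1 = k by [].
have ji : i != j by rewrite -val_eqE /= -ij ltn_eqF.
have ki : k != i by rewrite -val_eqE /= -ij gtn_eqF // ltnS leqW.
have kSi : k != i.+1 :> nat by rewrite ij gtn_eqF.
have iSj : i != j.+1 :> nat by rewrite -ij ltn_eqF // ltnS leqW.
apply: (quotient_braid3 (demazure_quotient i) (demazure_quotient j)) => /=.
- rewrite (extC_rootB ij) (extC_rootB jk) (rmorphB (refl i)) /=.
  by rewrite (refl_pxR ij) (refl_pxD ki kSi) addrA subrK.
- rewrite (extC_rootB ij) (extC_rootB jk) (rmorphB (refl j)) /=.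
  by rewrite (refl_pxL jk) (refl_pxD ji iSj) addrA subrK.
- exact: refl_braid3.
Qed.

Lemma demazure_braid4 i j f : i.+1 = j -> j.+1 = n ->
  demazure i (demazure j (demazure i (demazure j f))) =
  demazure j (demazure i (demazure j (demazure i f))).
Proof.
move=> ij e.
have ji : i != j by rewrite -val_eqE /= -ij ltn_eqF.
have iSj : i != j.+1 :> nat by rewrite -ij ltn_eqF // ltnS leqW.
have ix : refl j (px i) = px i by rewrite refl_pxD.
have [[iL iR] jN] := (refl_pxL ij, refl_pxR ij, refl_pxN e).
have rj : C (simple_root j) = px j *+ 2 by rewrite extC_root jN opprK.
(* The simple roots are [px i - px j] and [px j *+ 2]: the sign-change denominator doubles the
   variable and makes the second root long, whence [m = 2] and [k = 1]. The other positive roots are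
   [p] (short) and [q] (long). *)
apply: (quotient_braid4 (demazure_quotient i) (demazure_quotient j)
  (p := px i + px j) (q := px i *+ 2) (m := 2) (k := 1));
  rewrite ?(extC_rootB ij) ?rj /=.
- by rewrite (rmorphMn (refl i)) /= iR.
- by rewrite (rmorphB (refl j)) /= ix jN opprK.
- by rewrite (rmorphD (refl i)) /= iL iR addrC.
- by rewrite (rmorphMn (refl j)) /= ix.
- by rewrite mulrnBl addrC subrK.
- by rewrite mulrnDl.
- by rewrite mulr2n addrA subrK.
- by rewrite mulr1n mulr2n addrACA subrr addr0.
- exact: refl_braid4.
Qed.

End Demazure.

Theorem lemma2 (n : nat) (hn : (1 <= n)%N) :
  exists D : 'I_n -> {linear Pext n -> Pext n},
  [/\ forall (i : 'I_n) (d : Pext n -> Pext n),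
        divided_difference i d <-> d =1 D i,
      forall (i : 'I_n) (d : {linear Pext n -> Pext n}),
        demazure_generators i d /\ twisted_leibniz i d <-> d =1 D i
    & demazure_relations (fun i => D i)].
Proof.
exists (@demazure n); split.
- exact: divided_differenceP.
- exact: demazure_twisted_leibnizP.
split=> [i f|i j /orP[ij|ji] f|i j ij lt_jn f|i j ij e f] /=.
- exact: quotient_sq (demazure_quotient i) f.
- exact: demazureC.
- exact/esym/demazureC.
- exact: demazure_braid3.
- exact: demazure_braid4.
Qed.
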